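(* Let $N$ be the number of fermionic modes, let $n$ be the fermion number of the initial state, and let $\nu:=n/N$, where $\nu\le 1/2$ and $\nu$ is lower bounded by an arbitrarily small positive constant. Let $L,m$ be positive integers such that $Lm$ is a multiple of $N$. Let $A_1,A_2,\dots,A_m$ be $m$ possibly overlapping subsystems, each of which has exactly $L$ fermionic modes, and suppose that each fermionic mode in the system is in exactly $Lm/N$ out of these $m$ subsystems. Let $H=Q+\epsilon_1H_{\mathrm{SYK2}}+\epsilon_1\epsilon_2H_{\mathrm{SYK4}}$ be the Hamiltonian defined in the context, with $\epsilon_1,\epsilon_2$ infinitesimal, and let $\phi(t):=e^{-iHt}|\phi\rangle\langle\phi|e^{iHt}$ be the state at time $t$ evolved from $|\phi\rangle=a_1^\dagger a_2^\dagger\cdots a_n^\dagger|0\rangle$, with reduced density matrices $\phi(t)_{A_j}:=\mathrm{tr}_{\bar A_j}\phi(t)$. Then for any $N,h,J,t$ (that is, for every system size, every realization of the random couplings $h$ and $J$, and every time $t\in\mathbb R$), $$\frac1m\sum_{j=1}^mS(\phi(t)_{A_j})\le H_b(\nu)L .$$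
   Context: Fermionic system: $N$ modes with annihilation and creation operators $a_j,a_j^\dagger$ ($j\in[N]:=\{1,\dots,N\}$) satisfying the canonical anticommutation relations on the $2^N$-dimensional Fock space, with vacuum $|0\rangle$ (no fermions). $Q:=\sum_{j=1}^Na_j^\dagger a_j$ is the fermion number operator. $H_{\mathrm{SYK2}}:=a^\dagger ha=\sum_{j,k}h_{jk}a_j^\dagger a_k$, where $a=(a_1,\dots,a_N)^T$ and $h$ is a random $N\times N$ Hermitian matrix from the Gaussian unitary ensemble. $H_{\mathrm{SYK4}}:=\sum_{(j,k,l,r)\in\mathcal I}J_{jklr}a_j^\dagger a_k^\dagger a_la_r+\text{H.c.}$ (H.c. = Hermitian conjugate), where $\mathcal I:=\{(j,k,l,r)\in[N]^4: j<k,\ l<r,\ jN+k\le lN+r\}$ and $J=\{J_{jklr}\}_{(j,k,l,r)\in\mathcal I}$ is a collection of independent complex Gaussian random variables with zero mean and unit variance $\overline{|J_{jklr}|^2}=1$. The parameters $\epsilon_1,\epsilon_2$ are infinitesimal, so that $H$ is an infinitesimal perturbation of $Q$, and the SYK4 term is an infinitesimal perturbation relative to the SYK2 term. All of $Q,H_{\mathrm{SYK2}},H_{\mathrm{SYK4}},H$ commute with $Q$. For a subsystem (set of modes) $A$ with complement $\bar A$ and a state $\rho$ of definite fermion number, $\mathrm{tr}_{\bar A}\rho$ is the reduced density matrix: the density operator on the $2^{|A|}$-dimensional Fock space of the modes in $A$ that reproduces the expectation values of all operators in the algebra generated by $\{a_j,a_j^\dagger\}_{j\in A}$. $S(\rho)=-\mathrm{tr}(\rho\ln\rho)$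 is the von Neumann entropy. $H_b(\nu):=-\nu\ln\nu-(1-\nu)\ln(1-\nu)$ is the binary entropy function. *)

(* Defs.v *)
From mathcomp Require Import all_classical all_reals all_analysis.
From mathcomp Require Import all_boot all_order all_algebra.
From mathcomp Require Import spectral complex ring.

Set Implicit Arguments.
Unset Strict Implicit.
Unset Printing Implicit Defensive.

Import Order.TTheory GRing.Theory Num.Theory.
Import numFieldNormedType.Exports.

Local Open Scope ring_scope.
Local Open Scope complex_scope.
Local Open Scope sesquilinear_scope.

Section MatrixFunctions.
Context {R : realType}.
Local Notation C := R[i].

(* The exponential series; its limit is taken entrywise, on real and imaginary
   parts separately. *)
Definition expmx_partial d (M : 'M[C]_d) (k : nat) : 'M[C]_d :=
  \sum_(0 <= l < k) (l`!%:R)^-1 *: M ^+ l.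

Definition expmx d (M : 'M[C]_d) : 'M[C]_d :=
  \matrix_(x, y) (limn (fun k => complex.Re (expmx_partial M k x y))
                   +i* limn (fun k => complex.Im (expmx_partial M k x y))).

(* Functional calculus of a Hermitian matrix, for f : R -> R. *)
Definition herm_fun (f : R -> R) d (M : 'M[C]_d) : 'M[C]_d :=
  invmx (spectralmx M)
    *m diag_mx (map_mx (fun z => (f (complex.Re z))%:C) (spectral_diag M))
    *m spectralmx M.

Definition is_density d (M : 'M[C]_d) : Prop :=
  [/\ M \is hermsymmx,
      forall v : 'cV[C]_d, 0 <= (v ^t* *m M *m v) ord0 ord0
    & \tr M = 1].

(* The library sets ln 0 = 0, which gives the usual convention 0 ln 0 = 0. *)
Definition entropy d (M : 'M[C]_d) : R :=
  - complex.Re (\tr (M *m herm_fun (@ln R) M)).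

Definition binary_entropy (nu : R) : R :=
  - nu * ln nu - (1 - nu) * ln (1 - nu).

End MatrixFunctions.

Section Fock.
Context {R : realType} {N : nat}.
Local Notation C := R[i].

(* The Fock space of a set B of modes has the orthonormal occupation-number
   basis |X>, X \subset B, where
   |X> = a_{j_1}^dagger ... a_{j_k}^dagger |0>, X = {j_1 < ... < j_k}. *)
Definition fock_dim (B : {set 'I_N}) : nat := #|powerset B|.

Definition occ (B : {set 'I_N}) (x : 'I_(fock_dim B)) : {set 'I_N} :=
  enum_val x.

(* a_j |Y> = (-1)^(#{l in Y | l < j}) |Y \ {j}> if j is in Y, and 0 otherwise;
   only j \in B is meaningful. *)
Definition ann (B : {set 'I_N}) (j : 'I_N) : 'M[C]_(fock_dim B) :=
  \matrix_(x, y)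
    if (j \in occ y) && (occ x == occ y :\ j)
    then (-1) ^+ #|[set l in occ y | (l < j)%N]| else 0.

Definition cre (B : {set 'I_N}) (j : 'I_N) : 'M[C]_(fock_dim B) :=
  (ann B j) ^t*.

Definition vacuum (B : {set 'I_N}) : 'cV[C]_(fock_dim B) :=
  \col_x (occ x == set0)%:R.

(* Elements of the algebra generated by a_j, a_j^dagger for j in A, as
   noncommutative polynomials, so that the same element can be evaluated on
   the Fock space of any set of modes containing A. *)
Inductive mode_alg (A : {set 'I_N}) : Type :=
| AlgAnn (j : 'I_N) of j \in A
| AlgCre (j : 'I_N) of j \in A
| AlgOne
| AlgScale of C & mode_alg A
| AlgAdd of mode_alg A & mode_alg A
| AlgMul of mode_alg A & mode_alg A.

Fixpoint alg_eval (A B : {set 'I_N}) (e : mode_alg A) : 'M[C]_(fock_dim B) :=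
  match e with
  | AlgAnn j _ => ann B j
  | AlgCre j _ => cre B j
  | AlgOne => 1%:M
  | AlgScale c e1 => c *: alg_eval B e1
  | AlgAdd e1 e2 => alg_eval B e1 + alg_eval B e2
  | AlgMul e1 e2 => alg_eval B e1 *m alg_eval B e2
  end.

Definition is_reduced_density (A : {set 'I_N})
    (rho : 'M[C]_(fock_dim [set: 'I_N])) (sigma : 'M[C]_(fock_dim A)) : Prop :=
  is_density sigma /\
  forall e : mode_alg A,
    \tr (sigma *m alg_eval A e) = \tr (rho *m alg_eval [set: 'I_N] e).

Local Notation a := (ann [set: 'I_N]).
Local Notation "a^+" := (cre [set: 'I_N]).

Definition number_op : 'M[C]_(fock_dim [set: 'I_N]) :=
  \sum_(j < N) a^+ j *m a j.

Definition H_SYK2 (h : 'M[C]_N) : 'M[C]_(fock_dim [set: 'I_N]) :=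
  \sum_(j < N) \sum_(k < N) h j k *: (a^+ j *m a k).

(* Modes are numbered from 0; shifting all four indices by one does not change
   the conditions below. *)
Definition SYK4_index (j k l r : 'I_N) : bool :=
  [&& (j < k)%N, (l < r)%N & (j * N + k <= l * N + r)%N].

Definition SYK4_half (J : 'I_N -> 'I_N -> 'I_N -> 'I_N -> C) :
    'M[C]_(fock_dim [set: 'I_N]) :=
  \sum_(j < N) \sum_(k < N) \sum_(l < N) \sum_(r < N | SYK4_index j k l r)
    J j k l r *: (a^+ j *m a^+ k *m a l *m a r).

Definition H_SYK4 (J : 'I_N -> 'I_N -> 'I_N -> 'I_N -> C) :
    'M[C]_(fock_dim [set: 'I_N]) :=
  SYK4_half J + (SYK4_half J) ^t*.

Definition hamiltonian (eps1 eps2 : R) (h : 'M[C]_N)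
    (J : 'I_N -> 'I_N -> 'I_N -> 'I_N -> C) :
    'M[C]_(fock_dim [set: 'I_N]) :=
  number_op + eps1%:C *: H_SYK2 h + (eps1 * eps2)%:C *: H_SYK4 J.

Definition initial_state (n : nat) : 'cV[C]_(fock_dim [set: 'I_N]) :=
  (\prod_(j < N | (j < n)%N) a^+ j) *m vacuum [set: 'I_N].

Definition evolved_state (H : 'M[C]_(fock_dim [set: 'I_N]))
    (psi : 'cV[C]_(fock_dim [set: 'I_N])) (t : R) :
    'M[C]_(fock_dim [set: 'I_N]) :=
  expmx ((0 -i* t) *: H) *m (psi *m psi ^t*) *m expmx ((0 +i* t) *: H).

End Fock.

Lemma emb_mul_aux (K : comNzRingType) (s s' m m' u : K) : u * u = 1 ->
  s * s' * (m * m') = s * u * m * (u * s' * m').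
Proof. by move=> uu; rewrite -[LHS]mulr1 -uu; ring. Qed.

(* Existence of reduced density matrices: the *-embedding fock_emb of the
   operators on the Fock space of A sends a_j to a_j, and the reduced density
   matrix is the image of rho under the dual map. *)
Section Existence.
Context {R : realType} {N : nat}.
Local Notation C := R[i].
Local Notation T := [set: 'I_N].

Lemma occ_inj (B : {set 'I_N}) : injective (@occ N B).
Proof. exact: enum_val_inj. Qed.
Lemma occ_sub (B : {set 'I_N}) x : @occ N B x \subset B.
Proof. by have := enum_valP x; rewrite powersetE. Qed.

Lemma set0_powerset (B : {set 'I_N}) : set0 \in powerset B.
Proof. by rewrite powersetE sub0set. Qed.
Definition fock_idx (B S : {set 'I_N}) : 'I_(fock_dim B) :=
  enum_rank_in (set0_powerset B) S.
Lemma fock_idxK (B S : {set 'I_N}) : S \subset B -> occ (fock_idx B S) = S.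
Proof. by move=> SB; rewrite /occ /fock_idx enum_rankK_in ?powersetE. Qed.
Lemma occK (B : {set 'I_N}) x : fock_idx B (@occ N B x) = x.
Proof. by apply: occ_inj; rewrite fock_idxK ?occ_sub. Qed.

Variable A : {set 'I_N}.

Definition emb_sign (S : {set 'I_N}) : C :=
  \prod_(j in S :&: A) (-1) ^+ #|[set l in S :\: A | (l < j)%N]|.
Lemma emb_sign_sq S : emb_sign S * emb_sign S = 1.
Proof.
rewrite /emb_sign -big_split big1 //= => j _; by rewrite -expr2 sqrr_sign.
Qed.
Lemma emb_sign_conj S : Num.conj (emb_sign S) = emb_sign S.
Proof.
by rewrite /emb_sign rmorph_prod; apply: eq_bigr => j _; rewrite rmorph_sign.
Qed.

Definition fock_emb (M : 'M[C]_(fock_dim A)) : 'M[C]_(fock_dim T) :=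
  \matrix_(x, y) if occ x :\: A == occ y :\: A then
     emb_sign (occ x) * emb_sign (occ y) * M (fock_idx A (occ x :&: A)) (fock_idx A (occ y :&: A))
     else 0.

Lemma fock_embD M M' : fock_emb (M + M') = fock_emb M + fock_emb M'.
Proof.
apply/matrixP=> x y; rewrite !mxE; case: ifP => _; by rewrite ?mulrDr ?addr0.
Qed.
Lemma fock_embZ c M : fock_emb (c *: M) = c *: fock_emb M.
Proof.
apply/matrixP=> x y; rewrite !mxE; case: ifP => _; by rewrite ?mulr0 // mulrCA.
Qed.
Lemma fock_emb0 : fock_emb 0 = 0.
Proof. by rewrite -(scale0r 0) fock_embZ scale0r. Qed.
Lemma fock_emb_adj M : fock_emb (M ^t*) = (fock_emb M)^t*.
Proof.
apply/matrixP=> x y; rewrite !mxE eq_sym; case: ifP => _; last by rewrite rmorph0.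
by rewrite !rmorphM /= !emb_sign_conj [emb_sign (occ y) * _]mulrC.
Qed.
Lemma fock_emb1 : fock_emb 1%:M = 1%:M.
Proof.
apply/matrixP=> x y; rewrite !mxE; case: (x =P y) => [->|xy].
  by rewrite !eqxx mulr1 emb_sign_sq.
case: eqP => // e; case: eqP => [e2|]; last by rewrite mulr0.
case: xy; apply: occ_inj; rewrite -(setID (occ x) A) -(setID (occ y) A) e.
have := congr1 (@occ N A) e2; by rewrite !fock_idxK ?subsetIr // => ->.
Qed.
Lemma fock_embM M M' : fock_emb (M *m M') = fock_emb M *m fock_emb M'.
Proof.
apply/matrixP=> x y; rewrite !mxE.
have part z : (occ z :\: A == occ x :\: A) -> occ z = (occ z :&: A) :|: (occ x :\: A).
  by move/eqP <-; rewrite setID.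
rewrite [RHS](bigID (fun z : 'I_(fock_dim T) => occ z :\: A == occ x :\: A)) /=.
rewrite [X in _ = _ + X]big1 ?addr0; last first.
  by move=> z /negbTE; rewrite !mxE eq_sym => ->; rewrite mul0r.
pose f (p : 'I_(fock_dim A)) := fock_idx T (occ p :|: occ x :\: A).
have fA p : occ (f p) :&: A = occ p.
  rewrite fock_idxK ?subsetT //; apply/setP => i; rewrite !inE.
  case iA: (i \in A); rewrite /= ?orbF ?andbT //= andbF; apply/esym/negbTE.
  by apply: contraFN iA => /(subsetP (occ_sub p)).
have fD p : occ (f p) :\: A = occ x :\: A.
  rewrite fock_idxK ?subsetT // setDUl setDDl setUid.
  have /eqP -> : occ p :\: A == set0 by rewrite setD_eq0 occ_sub.
  by rewrite set0U.
have fK z : occ z :\: A == occ x :\: A -> f (fock_idx A (occ z :&: A)) = z.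
  by move=> hz; apply: occ_inj; rewrite !fock_idxK ?subsetT ?subsetIr // -part.
move: f fA fD fK => f fA fD fK.
rewrite (reindex_onto f (fun z => fock_idx A (occ z :&: A))) /=; last exact: fK.
rewrite [RHS](eq_bigl xpredT); last first.
  by move=> p; rewrite fD eqxx /= fA occK eqxx.
case: ifP => e; last first.
  by rewrite big1 // => p _; rewrite !mxE !fD e mulr0.
rewrite mulr_sumr; apply: eq_bigr => p _; rewrite !mxE !fD e eqxx fA occK.
set s := emb_sign (occ x); set s' := emb_sign (occ y); set u := emb_sign (occ (f p)).
have uu : u * u = 1 by exact: emb_sign_sq.
set m := M _ _; set m' := M' _ _.
exact: emb_mul_aux.
Qed.

Lemma fock_emb_ann j : j \in A -> fock_emb (ann A j) = ann T j.
Proof.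
move=> jA; apply/matrixP=> x y; rewrite !mxE.
rewrite !fock_idxK ?subsetIr // !inE jA andbT.
case jy: (j \in occ y) => /=; last by rewrite mulr0 if_same.
have -> : (occ x == occ y :\ j) = (occ x :\: A == occ y :\: A) && (occ x :&: A == (occ y :&: A) :\ j).
  apply/eqP/andP => [->|[/eqP e1 /eqP e2]].
    split; apply/eqP/setP => i; rewrite !inE; last by rewrite andbA.
    by case: eqP => // ->; rewrite jA.
  rewrite -(setID (occ x) A) e1 e2; apply/setP => i; rewrite !inE.
  by case: eqP => [->|_]; rewrite ?jA ?andbF //=; case: (i \in A); rewrite ?andbT ?andbF ?orbF.
case: eqP => //= e1; case: eqP => [e2|]; last by rewrite mulr0.
have jyA : j \in occ y :&: A by rewrite inE jy.
rewrite /emb_sign e1 e2 (big_setD1 j jyA) /=.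
have -> : forall a b c : C, a * a = 1 -> a * (b * a) * c = b * c.
  by move=> a b c aa; rewrite mulrCA aa mulr1.
  rewrite -exprD; congr (_ ^+ _).
  rewrite -cardsUI [X in (_ + X)%N](_ : _ = 0%N).
  rewrite addn0; apply: eq_card => l; rewrite !inE; by case: (l \in A) (l \in occ y) (l < j)%N => [] [] [].
  apply/eqP; rewrite cards_eq0; apply/eqP/setP=> l; rewrite !inE; by case: (l \in A); rewrite ?andbF.
by rewrite -big_split big1 //= => i _; rewrite -expr2 sqrr_sign.
Qed.

Lemma fock_emb_eval (e : @mode_alg R N A) : fock_emb (alg_eval A e) = alg_eval T e.
Proof.
elim: e => [j jA|j jA||c e IH|e IH e' IH'|e IH e' IH'] /=.
- exact: fock_emb_ann.
- by rewrite fock_emb_adj fock_emb_ann.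
- exact: fock_emb1.
- by rewrite fock_embZ IH.
- by rewrite fock_embD IH IH'.
- by rewrite fock_embM IH IH'.
Qed.

Definition partial_trace (rho : 'M[C]_(fock_dim T)) : 'M[C]_(fock_dim A) :=
  \matrix_(p, q) \tr (rho *m fock_emb (delta_mx q p)).

Lemma partial_traceP rho M : \tr (partial_trace rho *m M) = \tr (rho *m fock_emb M).
Proof.
rewrite {2}(matrix_sum_delta M) exchange_big /=.
rewrite (big_morph fock_emb fock_embD fock_emb0) mulmx_sumr raddf_sum /=; apply: eq_bigr => p _.
rewrite (big_morph fock_emb fock_embD fock_emb0) mulmx_sumr raddf_sum /= mxE; apply: eq_bigr => q _.
by rewrite fock_embZ -scalemxAr mxtraceZ !mxE mulrC.
Qed.

Lemma reduced_density_exists (rho : 'M[C]_(fock_dim T)) :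
  is_density rho -> exists sigma : 'M[C]_(fock_dim A), is_reduced_density rho sigma.
Proof.
move=> [rH rP r1]; exists (partial_trace rho); split; last first.
  by move=> e; rewrite partial_traceP fock_emb_eval.
have rE : rho = rho ^t* by have := is_hermitianmxP _ _ _ rH; rewrite expr0 scale1r.
split.
- apply/is_hermitianmxP; rewrite expr0 scale1r; apply/matrixP => p q; rewrite !mxE.
  have -> : Num.conj (\tr (rho *m fock_emb (delta_mx p q))) =\tr ((rho *m fock_emb (delta_mx p q)) ^t*).
    by rewrite /mxtrace rmorph_sum; apply: eq_bigr => i _; rewrite !mxE.
  rewrite trmx_mul map_mxM -rE -fock_emb_adj [RHS]mxtrace_mulC; congr (\tr (_ *m fock_emb _)).
  by apply/matrixP=> i k; rewrite !mxE rmorph_nat andbC.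
- move=> v; rewrite -[X in 0 <= X]/(_) -trace_mx11 -mulmxA mxtrace_mulC -mulmxA partial_traceP.
  pose W : 'M[C]_(fock_dim A) := v *m delta_mx ord0 (fock_idx A set0).
  have -> : v *m v ^t* = W *m W ^t*.
    rewrite /W trmx_mul map_mxM mulmxA -[v *m _ *m _]mulmxA.
    suff -> : (delta_mx ord0 (fock_idx A set0) *m (delta_mx ord0 (fock_idx A set0)) ^t* : 'M[C]_1) = 1%:M by rewrite mulmx1.
    by rewrite trmx_delta map_delta_mx mul_delta_mx; apply/matrixP=> i k; rewrite !mxE !ord1 !eqxx.
  rewrite fock_embM fock_emb_adj mulmxA mxtrace_mulC mulmxA; apply: sumr_ge0 => k _.
  have := rP (col k (fock_emb W)).
  congr (0 <= _); rewrite !mxE; apply: eq_bigr => i _; rewrite !mxE; congr (_ * _).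
  by apply: eq_bigr => l _; rewrite !mxE.
- by rewrite -[partial_trace rho]mulmx1 partial_traceP fock_emb1 mulmx1.
Qed.
End Existence.

(* Main.v *)
(* Klein's inequality bounds the entropy of a reduced density matrix by its
   cross entropy with the product state in which every mode of the subsystem is
   occupied with probability nu = n / N. The latter depends only, and affinely,
   on the mean occupations of the modes. Since every mode lies in equally many
   subsystems, averaging leaves only the total fermion number, which the
   evolution conserves and which equals n; so the average cross entropy is
   exactly H_b(nu) L. *)
Require Import Defs.
From mathcomp Require Import all_classical all_reals all_analysis.
From mathcomp Require Import all_boot all_order all_algebra.
From mathcomp Require Import spectral complex.
From mathcomp Require Import ring lra zify.

Set Implicit Arguments.
Unset Strict Implicit.
Unset Printing Implicit Defensive.

Import Order.TTheory GRing.Theory Num.Theory.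
Import numFieldNormedType.Exports.

Local Open Scope ring_scope.
Local Open Scope complex_scope.
Local Open Scope sesquilinear_scope.

(** * Spectral decomposition and Klein's inequality *)

Section Entropy.
Context {R : realType}.
Local Notation C := R[i].

Lemma complex_Re_sum (I : finType) (P : pred I) (F : I -> C) :
  complex.Re (\sum_(i | P i) F i) = \sum_(i | P i) complex.Re (F i).
Proof. by apply: (big_morph (@complex.Re R)) => // -[a b] [c d]. Qed.

Lemma complex_Re_nat (n : nat) : complex.Re (n%:R : C) = n%:R.
Proof. by rewrite -(rmorph_nat (real_complex R)). Qed.

Lemma complex_Re_mulr_real (z : C) (r : R) :
  complex.Re (z * r%:C) = complex.Re z * r.
Proof. by case: z => a b /=; rewrite mulr0 subr0. Qed.

(** Diagonalise [M] by a unitary [U]: [lam] is the spectrum and [w k x] is the squared modulus of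
    [U k x]. Unitarity makes [w] doubly stochastic, so the diagonal of [M] is a mixture of its
    eigenvalues, and what Klein's inequality needs becomes a statement about reals. *)
Lemma density_spectrum d (M : 'M[C]_d) : is_density M ->
  exists (lam : 'I_d -> R) (w : 'I_d -> 'I_d -> R),
  [/\ forall k, 0 <= lam k, \sum_k lam k = 1, forall k x, 0 <= w k x &
      [/\ forall k, \sum_x w k x = 1, forall x, \sum_k w k x = 1,
          forall x, complex.Re (M x x) = \sum_k w k x * lam k &
          entropy M = - \sum_k lam k * ln (lam k)]].
Proof.
move=> [Mherm Mpos Mtr].
have /orthomx_spectralP := hermitian_normalmx Mherm.
have Dreal := hermitian_spectral_diag_real Mherm.
have Uunit := spectral_unitarymx M.
have UV : spectralmx M *m (spectralmx M) ^t* = 1%:M by apply/unitarymxP.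
rewrite (invmx_unitary Uunit).
set U := spectralmx M in Uunit UV *; set D := spectral_diag M in Dreal * => ME.
have VU : U ^t* *m U = 1%:M by apply: mulmx1C.
have DE k : D ord0 k = (complex.Re (D ord0 k))%:C.
  by rewrite RRe_real //; apply: (mxOverP Dreal).
pose w k x := complex.Re (U k x) ^+ 2 + complex.Im (U k x) ^+ 2.
have wE k x : (w k x)%:C = U k x * Num.conj (U k x).
  by rewrite /w add_Re2_Im2 normCK.
exists (fun k => complex.Re (D ord0 k)), w; split.
- move=> k.
  (* Positivity is tested on the [k]-th eigenvector. *)
  have := Mpos ((row k U) ^t*).
  rewrite ME trmxCK -row_mul !mulmxA UV mul1mx.
  rewrite row_mul row_diag_mx -!scalemxAl -rowE mxE.
  suff -> : (row k U *m (row k U) ^t*) ord0 ord0 = 1 by rewrite mulr1 DE ler0c.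
  have /matrixP/(_ k k) := UV; rewrite !mxE eqxx mulr1n => <-.
  by apply: eq_bigr => x _; rewrite !mxE.
- apply: complexI; rewrite rmorph_sum /= rmorph1 -Mtr {1}ME mxtrace_mulC.
  by rewrite mulmxA UV mul1mx mxtrace_diag; apply: eq_bigr => k _; rewrite -DE.
- by move=> k x; rewrite /w addr_ge0 ?sqr_ge0.
split.
- move=> k; apply: complexI; rewrite rmorph_sum /= rmorph1.
  have /matrixP/(_ k k) := UV; rewrite !mxE eqxx mulr1n => <-.
  by apply: eq_bigr => x _; rewrite wE !mxE.
- move=> x; apply: complexI; rewrite rmorph_sum /= rmorph1.
  have /matrixP/(_ x x) := VU; rewrite !mxE eqxx mulr1n => <-.
  by apply: eq_bigr => k _; rewrite wE !mxE mulrC.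
- move=> x; rewrite {1}ME mul_mx_diag mxE complex_Re_sum; apply: eq_bigr => k _.
  rewrite !mxE DE -mulrA [_%:C * _]mulrC mulrA [Num.conj _ * _]mulrC -wE.
  by rewrite complex_Re_mulr_real.
- rewrite /entropy /herm_fun (invmx_unitary Uunit) -/U -/D {1}ME; congr (- _).
  rewrite !mulmxA -[_ *m U *m _ ^t*]mulmxA UV mulmx1.
  rewrite -!mulmxA mxtrace_mulC -!mulmxA UV mulmx1 mulmx_diag mxtrace_diag.
  rewrite complex_Re_sum; apply: eq_bigr => k _.
  by rewrite !mxE complex_Re_mulr_real.
Qed.

(** Klein's inequality against a diagonal state. The scalar bound
    [lam - p <= lam * ln lam - lam * ln p], weighted by [w k x] and summed, has left side
    [1 - 1 = 0]. *)
Lemma entropy_le_cross d (M : 'M[C]_d) (p : 'I_d -> R) : is_density M ->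
  (forall x, 0 < p x) -> \sum_x p x = 1 ->
  entropy M <= - \sum_x complex.Re (M x x) * ln (p x).
Proof.
move=> /density_spectrum[lam [w [lam0 lam1 w0 [wr wc MD ->]]]] p0 p1.
rewrite lerN2 -subr_ge0.
under [X in _ <= _ - X]eq_bigr do rewrite MD mulr_suml.
rewrite [X in _ <= _ - X]exchange_big /=.
have le k : \sum_x (w k x * lam k - w k x * p x) <=
    lam k * ln (lam k) - \sum_x w k x * lam k * ln (p x).
  rewrite -[lam k * ln _]mul1r -(wr k) mulr_suml -sumrB; apply: ler_sum => x _.
  rewrite -mulrBr -mulrA -mulrBr; apply: ler_wpM2l => //.
  (* For a zero eigenvalue the logarithmic terms vanish and only [- p x <= 0] remains. *)
  have [->|ln0] := eqVneq (lam k) 0; first by rewrite !mul0r subr0 sub0r oppr_le0 ltW.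
  have lk0 : 0 < lam k by rewrite lt_def ln0 lam0.
  (* This is [ln (1 + u) <= u] at [u = p x / lam k - 1]. *)
  have := @le_ln1Dx R (p x / lam k - 1).
  rewrite ltrBrDr addNr divr_gt0 // addrC subrK => /(_ isT).
  rewrite ln_div ?posrE // => /(ler_wpM2l (lam0 k)).
  rewrite mulrBr [X in _ <= X]mulrBr mulr1 mulrCA divff // mulr1.
  by rewrite -lerN2 !opprB -mulrBr.
rewrite -sumrB.
apply: le_trans _ (ler_sum _ (fun k _ => le k)).
under eq_bigr do rewrite sumrB -mulr_suml wr mul1r.
rewrite sumrB lam1 exchange_big /=.
by under eq_bigr do rewrite -mulr_suml wc mul1r; rewrite p1 subrr.
Qed.

End Entropy.

(** * Occupation-number basis and number operators *)

Section Fock.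
Context {R : realType} {N : nat}.
Local Notation C := R[i].

Lemma sum_occ (B : {set 'I_N}) (V : nmodType) (F : {set 'I_N} -> V) :
  \sum_(x < fock_dim B) F (occ x) = \sum_(X in powerset B) F X.
Proof. by rewrite [RHS]big_enum_val. Qed.

(** Normalisation of the product state. Expand a product of factors [F i + G i = 1] over all modes;
    a mode outside [B] has [F i = 0] and [G i = 1], so only subsets of [B] survive. *)
Lemma sum_powerset_binomial (B : {set 'I_N}) (nu : R) :
  \sum_(X in powerset B) nu ^+ #|X| * (1 - nu) ^+ (#|B| - #|X|) = 1.
Proof.
pose F (i : 'I_N) : R := if i \in B then nu else 0.
pose G (i : 'I_N) : R := if i \in B then 1 - nu else 1.
transitivity (\prod_i (F i + G i)); last first.
  rewrite big1 // => i _; rewrite /F /G; case: ifP => _; last by rewrite add0r.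
  by rewrite addrC subrK.
rewrite bigA_distr big_mkcond /=; apply: eq_bigr => X _; rewrite powersetE.
case: ifP => [XB|/negbT/subsetPn[i iX iB]]; last first.
  by rewrite (bigD1 i) //= iX /F (negbTE iB) mul0r.
rewrite -(cardsID X B) (setIidPr XB) addKn.
rewrite (bigID (mem X)) /=; congr (_ * _).
  rewrite -prodr_const; apply: eq_bigr => i iX.
  by rewrite iX /F (subsetP XB).
rewrite (bigID (mem B)) /= [X in _ = _ * X]big1 ?mulr1; last first.
  by move=> i /andP[/negbTE -> /negbTE iB]; rewrite /G iB.
rewrite -prodr_const; apply: eq_big => [i|i]; first by rewrite !inE.
by rewrite inE => /andP[/negbTE -> iB]; rewrite /G iB.
Qed.

(** Removing [j] is injective on the sets that contain [j], and the sign of [ann] squares to 1. *)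
Lemma cre_ann (B : {set 'I_N}) (j : 'I_N) :
  cre B j *m ann B j = diag_mx (\row_x (j \in occ x)%:R) :> 'M[C]_(fock_dim B).
Proof.
apply/matrixP => x y; rewrite !mxE.
have zE (z v : 'I_(fock_dim B)) :
    (occ z == occ v :\ j) = (z == fock_idx B (occ v :\ j)).
  rewrite -(inj_eq (@occ_inj N B)) fock_idxK //.
  by rewrite (subset_trans _ (occ_sub v)) ?subD1set.
have [jy|jy] := boolP (j \in occ y); last first.
  rewrite big1 => [|z _]; last by rewrite !mxE (negbTE jy) mulr0.
  by case: eqP => [->|]; rewrite ?mulr0n // (negbTE jy).
(* The only intermediate state that contributes is [occ y] without [j]. *)
rewrite (bigD1 (fock_idx B (occ y :\ j))) //= big1 ?addr0 => [|z zy]; last first.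
  by rewrite !mxE [occ z == occ y :\ j]zE (negbTE zy) andbF mulr0.
rewrite !mxE jy [in X in _ * X]zE eqxx /=.
rewrite zE; have [jx|jx] /= := boolP (j \in occ x); last first.
  by rewrite rmorph0 mul0r mul0rn.
have -> : (fock_idx B (occ y :\ j) == fock_idx B (occ x :\ j)) = (x == y).
  apply/eqP/eqP => [|->//] /(congr1 (@occ N B)).
  rewrite !fock_idxK ?(subset_trans (subD1set _ _)) ?occ_sub // => e.
  by apply: occ_inj; rewrite -(setD1K jx) -(setD1K jy) e.
case: eqP => [->|]; last by rewrite rmorph0 mul0r.
by rewrite rmorph_sign -expr2 sqrr_sign.
Qed.

Lemma trace_occupation (B : {set 'I_N}) (j : 'I_N) (M : 'M[C]_(fock_dim B)) :
  \tr (M *m (cre B j *m ann B j)) = \sum_x M x x * (j \in occ x)%:R.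
Proof.
by rewrite cre_ann mul_mx_diag; apply: eq_bigr => x _; rewrite !mxE.
Qed.

(** * Conservation of the fermion number *)

Lemma mulmx_neq0 (d1 d2 d3 : nat) (M : 'M[C]_(d1, d2)) (M' : 'M[C]_(d2, d3)) x y :
  (M *m M') x y != 0 -> exists z, M x z != 0 /\ M' z y != 0.
Proof.
rewrite mxE => nz.
have [z] : exists z, M x z * M' z y != 0.
  apply/existsP; apply: contraNT nz; rewrite negb_exists => /forallP z0.
  by rewrite big1 // => z _; apply/eqP; rewrite -[_ == _]negbK.
by rewrite mulf_eq0 negb_or => /andP[]; exists z.
Qed.

(* [M] adds [p] fermions and removes [q]. *)
Definition shifts (p q : nat) (B : {set 'I_N}) (M : 'M[C]_(fock_dim B)) :=
  forall x y, M x y != 0 -> (#|occ x| + q = #|occ y| + p)%N.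

Lemma shiftsM p q p' q' B (M M' : 'M[C]_(fock_dim B)) :
  shifts p q M -> shifts p' q' M' -> shifts (p + p') (q + q') (M *m M').
Proof.
by move=> hM hM' x y /mulmx_neq0[z [/hM e /hM' e']]; lia.
Qed.

Lemma shifts0 p q B : shifts p q (0 : 'M[C]_(fock_dim B)).
Proof. by move=> x y; rewrite mxE eqxx. Qed.

Lemma shiftsD p q B (M M' : 'M[C]_(fock_dim B)) :
  shifts p q M -> shifts p q M' -> shifts p q (M + M').
Proof.
move=> hM hM' x y; rewrite mxE => nz.
have [M0|/hM//] := eqVneq (M x y) 0.
by apply: hM'; rewrite M0 add0r in nz.
Qed.

Lemma shifts_sum p q B (I : Type) (r : seq I) (P : pred I)
    (F : I -> 'M[C]_(fock_dim B)) :
  (forall i, P i -> shifts p q (F i)) -> shifts p q (\sum_(i <- r | P i) F i).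
Proof. by move=> hF; elim/big_ind: _ => //; [exact: shifts0|exact: shiftsD]. Qed.

Lemma shiftsZ p q B c (M : 'M[C]_(fock_dim B)) :
  shifts p q M -> shifts p q (c *: M).
Proof. by move=> hM x y; rewrite mxE mulf_eq0 negb_or => /andP[_ /hM]. Qed.

Lemma shifts_adj p q B (M : 'M[C]_(fock_dim B)) :
  shifts p q M -> shifts q p (M ^t*).
Proof. by move=> hM x y; rewrite !mxE conjC_eq0 => /hM. Qed.

Lemma shifts_scalar B c : shifts 0 0 (c%:M : 'M[C]_(fock_dim B)).
Proof. by move=> x y; rewrite mxE; have [->|_] := eqVneq x y; rewrite ?eqxx. Qed.

Lemma shifts_ann B j : shifts 0 1 (ann B j : 'M[C]_(fock_dim B)).
Proof.
move=> x y; rewrite mxE; case: ifP => [/andP[jy /eqP ->]|]; last by rewrite eqxx.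
by rewrite addn0 addn1 (cardsD1 j (occ y)) jy.
Qed.

Lemma shifts_cre B j : shifts 1 0 (cre B j : 'M[C]_(fock_dim B)).
Proof. exact/shifts_adj/shifts_ann. Qed.

Lemma shifts_balanced p B (M : 'M[C]_(fock_dim B)) :
  shifts p p M -> shifts 0 0 M.
Proof. by move=> hM x y /hM /addIn ->. Qed.

(* The entries between different fermion numbers vanish in every partial sum, so
   the convergence of the exponential series is not needed. *)
Lemma shifts_expmx B (M : 'M[C]_(fock_dim B)) :
  shifts 0 0 M -> shifts 0 0 (expmx M).
Proof.
move=> hM x y; rewrite mxE.
have hP k : shifts 0 0 (expmx_partial M k).
  apply: shifts_sum => l _; apply: shiftsZ; elim: l => [|l IH].
    by rewrite expr0; exact: shifts_scalar.
  by rewrite exprS; apply: (shiftsM hM IH).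
have [->//|ne] := eqVneq #|occ x| #|occ y|.
have P0 k : expmx_partial M k x y = 0.
  by apply: contra_neq_eq ne => /hP; rewrite !addn0.
under eq_fun do rewrite P0.
under [X in _ +i* limn X]eq_fun do rewrite P0.
by rewrite /= lim_cst // eqxx.
Qed.

Local Notation T := [set: 'I_N].

(** Each term contains as many creation as annihilation operators. *)
Lemma shifts_hamiltonian eps1 eps2 (h : 'M[C]_N) J :
  shifts 0 0 (hamiltonian eps1 eps2 h J).
Proof.
have h2 j k : shifts 0 0 (cre T j *m ann T k : 'M[C]_(fock_dim T)).
  by have /(@shifts_balanced 1) := shiftsM (@shifts_cre T j) (@shifts_ann T k).
have h4 : shifts 0 0 (SYK4_half J).
  apply: shifts_sum => j _; apply: shifts_sum => k _.
  apply: shifts_sum => l _; apply: shifts_sum => r _; apply: shiftsZ.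
  have hcre := shiftsM (@shifts_cre T j) (@shifts_cre T k).
  by have /(@shifts_balanced 2) :=
    shiftsM (shiftsM hcre (@shifts_ann T l)) (@shifts_ann T r).
apply: shiftsD; first apply: shiftsD.
- by apply: shifts_sum => j _.
- by apply: shiftsZ; do 2!apply: shifts_sum => ? _; apply: shiftsZ.
- by apply/shiftsZ/shiftsD => //; exact: shifts_adj.
Qed.

Lemma initial_state_number n x : (n <= N)%N ->
  (initial_state n : 'cV[C]_(fock_dim T)) x ord0 != 0 -> #|occ x| = n.
Proof.
move=> nN /mulmx_neq0[z [+ +]]; rewrite [vacuum _ _ _]mxE.
(* The product is generalised to an arbitrary list of modes for the induction; each factor kept by
   the filter adds one fermion. *)
have hP (r : seq 'I_N) :
    shifts (count (fun j : 'I_N => (j < n)%N) r) 0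
      (\prod_(j <- r | (j < n)%N) cre T j : 'M[C]_(fock_dim T)).
  elim: r => [|j r IH]; first by rewrite big_nil; exact: shifts_scalar.
  rewrite big_cons /=; case: ifP => _ //; exact: (shiftsM (@shifts_cre T j) IH).
move=> /hP; rewrite addn0 => ->.
case: (occ z =P set0) => [->|]; last by rewrite eqxx.
by rewrite cards0 add0n -sum1_count (big_ord_narrow nN) sum1_card card_ord.
Qed.

Lemma evolved_state_number eps1 eps2 (h : 'M[C]_N) J n t x : (n <= N)%N ->
  evolved_state (hamiltonian eps1 eps2 h J) (initial_state n) t x x != 0 ->
  #|occ x| = n.
Proof.
(* Regrouped as a column times a row, a nonzero diagonal entry forces the entry [x] of the evolved
   vector to be nonzero. *)
move=> nN; rewrite /evolved_state mulmxA -mulmxA => /mulmx_neq0[i []].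
rewrite ord1 => /mulmx_neq0[z [+ /(initial_state_number nN) <-] _].
have hU : shifts 0 0 (expmx ((0 -i* t) *: hamiltonian eps1 eps2 h J)).
  exact/shifts_expmx/shiftsZ/shifts_hamiltonian.
by move/hU; rewrite !addn0.
Qed.

(** * Entropy bound from mean occupations *)

Lemma sum_trace_occupation (B : {set 'I_N}) (M : 'M[C]_(fock_dim B)) :
  \sum_(j in B) \tr (M *m (cre B j *m ann B j)) = \sum_x M x x * #|occ x|%:R.
Proof.
under eq_bigr do rewrite trace_occupation.
rewrite exchange_big /=; apply: eq_bigr => x _.
rewrite -mulr_sumr -natr_sum; congr (_ * _%:R).
rewrite -[in RHS](setIidPr (occ_sub x)) -sum1_card big_mkcond [RHS]big_mkcond.
by apply: eq_bigr => j _; rewrite inE; case: (j \in B); case: (j \in occ x).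
Qed.

(** Cross entropy with the product state [p]: [ln (p X)] is affine in the cardinality of [X], so its
    mean depends on [M] only through the mean fermion number [q]. *)
Lemma entropy_le_occupation (B : {set 'I_N}) (nu q : R) (M : 'M[C]_(fock_dim B)) :
  0 < nu < 1 -> is_density M ->
  \sum_(j in B) complex.Re (\tr (M *m (cre B j *m ann B j))) = q ->
  entropy M <= - (q * ln nu + (#|B|%:R - q) * ln (1 - nu)).
Proof.
case/andP=> nu0 nu1 dM qB.
have mu0 : 0 < 1 - nu by rewrite subr_gt0.
pose p (X : {set 'I_N}) := nu ^+ #|X| * (1 - nu) ^+ (#|B| - #|X|).
have := @entropy_le_cross _ _ M (fun x => p (occ x)) dM.
rewrite sum_occ sum_powerset_binomial => /(_ _ erefl).
move=> le; apply: le_trans (le _) _ => [x|]; first by rewrite mulr_gt0 ?exprn_gt0.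
rewrite lerN2 le_eqVlt; apply/orP; left; apply/eqP.
have qE : q = \sum_x complex.Re (M x x) * #|occ x|%:R.
  rewrite -qB -complex_Re_sum sum_trace_occupation complex_Re_sum.
  apply: eq_bigr => x _.
  by rewrite -(rmorph_nat (real_complex R)) complex_Re_mulr_real.
have tr1 : \sum_x complex.Re (M x x) = 1.
  by rewrite -complex_Re_sum; have [_ _] := dM; rewrite /mxtrace => ->.
have BE : #|B|%:R = \sum_x complex.Re (M x x) * #|B|%:R.
  by rewrite -mulr_suml tr1 mul1r.
rewrite BE qE -sumrB !mulr_suml -big_split /=.
apply: eq_bigr => x _; rewrite lnM ?posrE ?exprn_gt0 // !lnXn //.
rewrite -!(mulr_natr (ln _)) natrB ?subset_leq_card ?occ_sub //.
by ring.
Qed.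

End Fock.

(** * Averaging over the subsystems *)

Theorem theorem2 (R : realType) (N n L m : nat) (c : R)
  (hN : (0 < N)%N) (hL : (0 < L)%N) (hm : (0 < m)%N)
  (hc : 0 < c) (hnu_lb : c <= n%:R / N%:R) (hnu_ub : n%:R / N%:R <= 1 / 2 :> R)
  (hdvd : (N %| L * m)%N)
  (A : 'I_m -> {set 'I_N})
  (hAsize : forall j : 'I_m, #|A j| = L)
  (hAcover : forall i : 'I_N, #|[set j : 'I_m | i \in A j]| = (L * m %/ N)%N)
  (eps1 eps2 : R)
  (h : 'M[R[i]]_N) (hherm : h \is hermsymmx)
  (J : 'I_N -> 'I_N -> 'I_N -> 'I_N -> R[i])
  (t : R)
  (sigma : forall j : 'I_m, 'M[R[i]]_(fock_dim (A j)))
  (hsigma : forall j : 'I_m,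
     is_reduced_density
       (evolved_state (hamiltonian eps1 eps2 h J) (initial_state n) t)
       (sigma j)) :
  m%:R^-1 * \sum_(j < m) entropy (sigma j)
    <= binary_entropy (n%:R / N%:R) * L%:R.
Proof.
set rho := evolved_state _ _ _ in hsigma.
set nu : R := n%:R / N%:R in hnu_lb hnu_ub *.
have N0 : (N%:R : R) != 0 by rewrite pnatr_eq0 -lt0n.
have nu01 : 0 < nu < 1 by apply/andP; split; lra.
have nN : (n <= N)%N.
  rewrite -(ler_nat R) -[N%:R]mul1r -ler_pdivrMr ?ltr0n //.
  by case/andP: nu01 => _ /ltW.
(* The unit of the mode algebra carries the trace 1 of a reduced density matrix over to [rho]; [hm]
   supplies a subsystem. *)
have tr1 : \tr rho = 1.
  have [[_ _ <-] /(_ (AlgOne _))] := hsigma (Ordinal hm).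
  by rewrite /= !mulmx1.
(* The mean occupations of the global state; they sum to [n] because the diagonal of [rho] lives on
   states with [n] fermions. *)
pose q i := complex.Re (\tr (rho *m (cre [set: 'I_N] i *m ann [set: 'I_N] i))).
have sumq : \sum_i q i = n%:R.
  rewrite -complex_Re_sum -(eq_bigl _ _ (@in_setT _)) sum_trace_occupation.
  rewrite -complex_Re_nat -[in RHS](mul1r n%:R) -tr1 mulr_suml.
  congr complex.Re; apply: eq_bigr => x _.
  have [->|/(evolved_state_number nN) ->//] := eqVneq (rho x x) 0.
  by rewrite !mul0r.
(* The number operator of a mode of [A k] lies in its mode algebra, so the reduced state has the
   same mean occupation. *)
have qE k i : i \in A k ->
    complex.Re (\tr (sigma k *m (cre (A k) i *m ann (A k) i))) = q i.
  move=> iA; have [_ /(_ (AlgMul (AlgCre iA) (AlgAnn iA)))] := hsigma k.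
  by move=> /= ->.
have le k : entropy (sigma k) <=
    - ((\sum_(i in A k) q i) * ln nu + (L%:R - \sum_(i in A k) q i) * ln (1 - nu)).
  have [dk _] := hsigma k.
  by have := entropy_le_occupation nu01 dk (eq_bigr _ (qE k)); rewrite hAsize.
(* Double counting: every mode occurs in [L * m %/ N] subsystems, and [hdvd] makes this quotient
   exact. *)
have sumA : \sum_k \sum_(i in A k) q i = m%:R * (nu * L%:R).
  rewrite (exchange_big_dep xpredT) //=.
  transitivity (\sum_i q i * (L * m %/ N)%:R).
    apply: eq_bigr => i _; rewrite sumr_const -(hAcover i) mulr_natr.
    by congr (_ *+ _); apply: eq_card => k; rewrite inE.
  rewrite -mulr_suml sumq /nu.
  have -> : ((L * m %/ N)%:R : R) = L%:R * m%:R / N%:R.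
    by rewrite -natrM -[in RHS](divnK hdvd) natrM mulfK.
  by ring.
rewrite mulrC ler_pdivrMr ?ltr0n //; apply: le_trans (ler_sum _ (fun k _ => le k)) _.
rewrite sumrN big_split /= -!mulr_suml sumrB sumA sumr_const card_ord -mulr_natr.
(* The bounds are affine in the occupations, so their sum equals the right-hand side exactly. *)
rewrite /binary_entropy le_eqVlt; apply/orP; left; apply/eqP.
by ring.
Qed.
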